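(* Let $X$ be a compact and locally connected topological space and let $f\colon X\to X$ be continuous. Assume that the induced map $f^*\colon \check H^1(X;\mathbb C)\to\check H^1(X;\mathbb C)$ in Čech cohomology has an eigenvalue $\lambda\in\mathbb C$ with modulus $|\lambda|>1$. Then the topological entropy of $f$ satisfies $h(f)\ge \log|\lambda|$.
   Context: $\check H^q(X;\mathbb C)$ denotes Čech cohomology: the direct limit, over all open coverings $\mathcal U$ of $X$ ordered by refinement, of the simplicial cohomology groups $H^q(N(\mathcal U);\mathbb C)$ of the nerves of the coverings (for compact $X$ finite coverings suffice). Equivalently it is the direct limit of the cohomology of the Vietoris complexes $V(\mathcal U)$, whose vertices are the points of $X$ and whose simplices are the finite nonempty subsets of $X$ contained in some element of $\mathcal U$; or the Alexander--Spanier cohomology of $X$. Topological entropy (Adler--Konheim--McAndrew): for an open covering $\mathcal U$ of the compact space $X$ let $s(\mathcal U)$ be the minimum cardinality of a subcover of $\mathcal U$. Write $\mathcal U\vee\mathcal V=\{U\cap V: U\in\mathcal U,V\in\mathcal V\}$, $f^{-1}\mathcal U=\{f^{-1}(U):U\in\mathcal U\}$ and $\mathcal U^n=\mathcal U\vee f^{-1}\mathcal U\vee\cdots\vee f^{-n}\mathcal U$. Then $h(f,\mathcal U)=\lim_{n\to\infty}\frac1n\log s(\mathcal U^n)$ (the limit exists), and $h(f)=\sup_{\mathcal U}h(f,\mathcal U)\in[0,\infty]$, the supremum being over all open coverings of $X$. *)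

(* Defs.v *)
From HB Require Import structures.
From mathcomp Require Import all_boot all_order all_algebra.
From mathcomp Require Import generic_quotient zify.
From mathcomp Require Import complex.
From mathcomp Require Import all_classical all_reals all_analysis.

Set Implicit Arguments.
Unset Strict Implicit.
Unset Printing Implicit Defensive.

Import Order.TTheory GRing.Theory Num.Theory.
Import numFieldNormedType.Exports.

Local Open Scope classical_set_scope.
Local Open Scope ring_scope.
Local Open Scope quotient_scope.

Record open_cover (X : topologicalType) := OpenCover {
  members :> set (set X);
  open_members : forall A, members A -> open A;
  members_cover : \bigcup_(A in members) A = [set: X] }.

(* Ordered q-simplices of the nerve of U: the vertices may repeat.  The
   ordered cochain complex computes the simplicial cohomology of the nerve;
   in degree 1 the cocycle identity forces c(A, A) = 0 and
   c(B, A) = - c(A, B), so 1-cocycles are automatically alternating. *)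
Record simplex (X : Type) (U : set (set X)) (q : nat) := Simplex {
  vertex :> 'I_q.+1 -> set X;
  vertexP : forall i, U (vertex i);
  vertex_meet : \bigcap_i vertex i !=set0 }.

Notation cochain K U q := (simplex U q -> K^o).

Section Nerve.
Variables (K : fieldType) (X : Type) (U : set (set X)).

Lemma simplex_eq q (s t : simplex U q) : (forall i, s i = t i) -> s = t.
Proof.
case: s t => [s sU sI] [t tU tI] /= /funext st; subst t.
by congr Simplex; exact: Prop_irrelevance.
Qed.

Lemma face_meet q (s : simplex U q.+1) (i : 'I_q.+2) :
  \bigcap_k s (lift i k) !=set0.
Proof. by have [x sx] := vertex_meet s; exists x => k _; exact: sx. Qed.

Definition face q (s : simplex U q.+1) (i : 'I_q.+2) : simplex U q :=
  Simplex (fun k => vertexP s (lift i k)) (face_meet s i).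

Definition coboundary_op q (c : cochain K U q) : cochain K U q.+1 :=
  fun s => \sum_(i < q.+2) (-1) ^+ i *: c (face s i).

Lemma coboundary_op_is_linear q : linear (@coboundary_op q).
Proof.
move=> a c e; apply/funext => s; rewrite /coboundary_op /=.
rewrite !fctE scaler_sumr -big_split /=; apply: eq_bigr => i _.
by rewrite scalerDr !scalerA mulrC.
Qed.

HB.instance Definition _ q := @GRing.isLinear.Build K
  (cochain K U q) (cochain K U q.+1) _ (@coboundary_op q)
  (@coboundary_op_is_linear q).

Definition cocycles q : set (cochain K U q) :=
  [set c | coboundary_op c = 0].

Definition coboundaries q : set (cochain K U q) :=
  match q with
  | 0 => [set 0]
  | r.+1 => range (@coboundary_op r)
  end.

End Nerve.
Arguments coboundary_op {K X U q} c.
Arguments cocycles {K X U q}.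
Arguments coboundaries {K X U q}.

(* p sends each member A of V to a member of U containing f(A).  For f = id
   this is a refinement projection from V to U; for V the cover f^-1(U) it is
   a vertex map inducing the pullback along f. *)
Definition vertex_map (X Y : Type) (f : X -> Y) (p : set X -> set Y)
    (V : set (set X)) (U : set (set Y)) :=
  forall A, V A -> U (p A) /\ A `<=` f @^-1` p A.

Section Pullback.
Variables (K : fieldType) (X Y : Type) (f : X -> Y).
Variables (V : set (set X)) (U : set (set Y)).

Section Map.
Variables (p : set X -> set Y) (hp : vertex_map f p V U).

Lemma map_simplexP q (s : simplex V q) i : U (p (s i)).
Proof. exact: (hp (vertexP s i)).1. Qed.

Lemma map_simplex_meet q (s : simplex V q) : \bigcap_i p (s i) !=set0.
Proof.
have [x sx] := vertex_meet s; exists (f x) => i _.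
exact: (hp (vertexP s i)).2 (sx i I).
Qed.

Definition map_simplex q (s : simplex V q) : simplex U q :=
  Simplex (map_simplexP s) (map_simplex_meet s).

Definition pullback q (c : cochain K U q) : cochain K V q :=
  c \o @map_simplex q.

Lemma pullback_coboundary q (c : cochain K U q) :
  coboundary_op (pullback c) = pullback (coboundary_op c).
Proof.
apply/funext => s; rewrite /coboundary_op /pullback /=.
by apply: eq_bigr => i _; congr (_ *: c _); exact: simplex_eq.
Qed.

Lemma pullback_cocycle q (c : cochain K U q) :
  cocycles c -> cocycles (pullback c).
Proof. by rewrite /cocycles /= pullback_coboundary => ->. Qed.

Lemma pullback_coboundaries q (c : cochain K U q) :
  coboundaries c -> coboundaries (pullback c).
Proof.
case: q c => [|q] c /=; first by move=> ->.
by move=> [b _ <-]; exists (pullback b) => //; rewrite pullback_coboundary.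
Qed.

End Map.

Section Prism.
Variables (p g : set X -> set Y).
Variables (hp : vertex_map f p V U) (hg : vertex_map f g V U).

Definition prism_vertex q (i : nat) (s : 'I_q.+1 -> set X) (k : 'I_q.+2) :
    set Y :=
  (if (k <= i)%N then p else g) (s (inord (unbump i k))).

Lemma prismP q i (s : simplex V q) k : U (prism_vertex i s k).
Proof.
rewrite /prism_vertex; case: ifP => _.
  exact: (hp (vertexP s _)).1.
exact: (hg (vertexP s _)).1.
Qed.

Lemma prism_meet q i (s : simplex V q) : \bigcap_k prism_vertex i s k !=set0.
Proof.
have [x sx] := vertex_meet s; exists (f x) => k _.
rewrite /prism_vertex; case: ifP => _.
  exact: (hp (vertexP s _)).2 (sx _ I).
exact: (hg (vertexP s _)).2 (sx _ I).
Qed.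

Definition prism q i (s : simplex V q) : simplex U q.+1 :=
  Simplex (prismP i s) (prism_meet i s).

Definition homotopy q (c : cochain K U q.+1) : cochain K V q :=
  fun s => \sum_(i < q.+1) (-1) ^+ i *: c (prism i s).

Definition mixed_vertex q (i : nat) (s : 'I_q.+1 -> set X) (k : 'I_q.+1) :
    set Y := (if (k < i)%N then p else g) (s k).

Lemma mixedP q i (s : simplex V q) k : U (mixed_vertex i s k).
Proof.
rewrite /mixed_vertex; case: ifP => _.
  exact: (hp (vertexP s _)).1.
exact: (hg (vertexP s _)).1.
Qed.

Lemma mixed_meet q i (s : simplex V q) : \bigcap_k mixed_vertex i s k !=set0.
Proof.
have [x sx] := vertex_meet s; exists (f x) => k _.
rewrite /mixed_vertex; case: ifP => _.
  exact: (hp (vertexP s _)).2 (sx _ I).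
exact: (hg (vertexP s _)).2 (sx _ I).
Qed.

Definition mixed q i (s : simplex V q) : simplex U q :=
  Simplex (mixedP i s) (mixed_meet i s).

Lemma mixed0 q (s : simplex V q) : mixed 0 s = map_simplex hg s.
Proof. exact: simplex_eq. Qed.

Lemma mixed_last q (s : simplex V q) : mixed q.+1 s = map_simplex hp s.
Proof. by apply: simplex_eq => k /=; rewrite /mixed_vertex ltn_ord. Qed.

Lemma face_prism_diag q i (s : simplex V q) : (i < q.+1)%N ->
  face (prism i s) (inord i) = mixed i s.
Proof.
move=> iq; apply: simplex_eq => k /=.
rewrite /prism_vertex /mixed_vertex /= inordK; last by lia.
have kq := ltn_ord k.
have -> : (bump i k <= i)%N = (k < i)%N by rewrite /bump; lia.
by congr ((if _ then _ else _) (s _)); apply: val_inj; rewrite /= bumpK inordK.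
Qed.

Lemma face_prism_diagS q i (s : simplex V q) : (i < q.+1)%N ->
  face (prism i s) (inord i.+1) = mixed i.+1 s.
Proof.
move=> iq; apply: simplex_eq => k /=.
rewrite /prism_vertex /mixed_vertex /= inordK; last by lia.
have kq := ltn_ord k.
have -> : (bump i.+1 k <= i)%N = (k < i.+1)%N by rewrite /bump; lia.
congr ((if _ then _ else _) (s _)); apply: val_inj; rewrite /= inordK;
  rewrite /bump /unbump; lia.
Qed.

Lemma face_prism_lt q i j (s : simplex V q.+1) : (j < i)%N -> (i < q.+2)%N ->
  face (prism i s) (inord j) = prism i.-1 (face s (inord j)).
Proof.
move=> ji iq; apply: simplex_eq => k /=.
rewrite /prism_vertex /= inordK; last by lia.
have kq := ltn_ord k.
have -> : (bump j k <= i)%N = (k <= i.-1)%N by rewrite /bump; lia.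
congr ((if _ then _ else _) (s _)); apply: val_inj; rewrite /= !inordK;
  rewrite /bump /unbump; lia.
Qed.

Lemma face_prism_gt q i j (s : simplex V q.+1) :
  (i < j)%N -> (j < q.+2)%N ->
  face (prism i s) (inord j.+1) = prism i (face s (inord j)).
Proof.
move=> ij jq; apply: simplex_eq => k /=.
rewrite /prism_vertex /= inordK; last by lia.
have kq := ltn_ord k.
have -> : (bump j.+1 k <= i)%N = (k <= i)%N by rewrite /bump; lia.
congr ((if _ then _ else _) (s _)); apply: val_inj; rewrite /= !inordK;
  rewrite /bump /unbump; lia.
Qed.

Lemma prism_sum (M : zmodType) q (F G : nat -> nat -> M) (T : nat -> M) :
  (forall i j, (j < i)%N -> (i < q.+1)%N -> F i j = - G j i.-1) ->
  (forall i j, (i < j)%N -> (j < q.+1)%N -> F i j.+1 = - G j i) ->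
  (forall i, (i < q.+1)%N -> F i i = T i) ->
  (forall i, (i < q.+1)%N -> F i i.+1 = - T i.+1) ->
  \sum_(0 <= i < q.+1) \sum_(0 <= j < q.+2) F i j =
  T 0%N - T q.+1 - \sum_(0 <= j < q.+1) \sum_(0 <= i < q) G j i.
Proof.
move=> Flt Fgt Fd FdS.
transitivity (\sum_(0 <= i < q.+1) ((T i - T i.+1) -
   (\sum_(0 <= j < i) G j i.-1 + \sum_(i.+1 <= j < q.+1) G j i))).
  apply: eq_big_nat => i /andP[_ iq].
  rewrite (big_cat_nat (n := i)) //=; last by lia.
  rewrite (@big_ltn _ _ _ i); last by lia.
  rewrite (@big_ltn _ _ _ i.+1); last by lia.
  rewrite Fd // FdS // big_add1 /=.
  rewrite (@eq_big_nat _ _ _ 0 i _ (fun j => - G j i.-1)); last first.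
    by move=> j /andP[_ ji]; rewrite Flt.
  rewrite (@eq_big_nat _ _ _ i.+1 q.+1 _ (fun j => - G j i)); last first.
    by move=> j /andP[ij jq]; rewrite Fgt.
  by rewrite !sumrN opprD addrCA -!addrA; congr (_ + _); rewrite addrCA.
rewrite sumrB; congr (_ - _).
  rewrite -(opprB (T q.+1)) -(telescope_sumr T (leq0n q.+1)) -sumrN.
  by apply: eq_bigr => i _; rewrite opprB.
rewrite big_split /= big_nat_recl // big_geq // add0r /=.
rewrite [X in _ + X]big_nat_recr //= [X in _ + (_ + X)]big_geq // addr0.
rewrite -big_split /= [RHS]exchange_big_nat /=; apply: eq_big_nat => i /andP[_ iq].
by rewrite [RHS](big_cat_nat (n := i.+1)) //=; lia.
Qed.

Lemma homotopyE q (c : cochain K U q) (s : simplex V q) :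
  (\sum_(0 <= i < q.+1) \sum_(0 <= j < q.+2)
     (-1) ^+ (i + j) *: c (face (prism i s) (inord j))) =
  homotopy (coboundary_op c) s.
Proof.
rewrite /homotopy big_mkord; apply: eq_bigr => i _.
rewrite /coboundary_op scaler_sumr big_mkord; apply: eq_bigr => j _.
by rewrite scalerA exprD inord_val.
Qed.

(* Two vertex maps over the same f are contiguous, hence induce the same map
   on cohomology. *)
Lemma pullback_contiguous q (c : cochain K U q) : cocycles c ->
  coboundaries (pullback hg c - pullback hp c).
Proof.
move=> dc.
have H0 s : homotopy (coboundary_op c) s = 0.
  rewrite dc /homotopy big1 // => i _; exact: scaler0.
case: q c dc H0 => [|q] c dc H0.
  apply/funext => s; rewrite !fctE.
  rewrite -[RHS](H0 s) -homotopyE !big_nat1 big_nat_recl //= big_nat1.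
  rewrite face_prism_diag // face_prism_diagS // mixed0 mixed_last.
  by rewrite expr0 expr1 scale1r scaleN1r.
exists (homotopy c) => //; apply/funext => s.
have := H0 s; rewrite -homotopyE
  (@prism_sum _ q.+1 _ (fun j i => (-1) ^+ (i + j) *: c (prism i (face s (inord j))))
     (fun i => c (mixed i s))).
- rewrite mixed0 mixed_last => /eqP; rewrite subr_eq0 => /eqP E.
  rewrite !fctE /pullback /= -[RHS]/(c (map_simplex hg s) - c (map_simplex hp s)).
  rewrite E /coboundary_op big_mkord; apply: eq_bigr => j _.
  rewrite /homotopy scaler_sumr big_mkord; apply: eq_bigr => i _.
  by rewrite scalerA exprD mulrC inord_val.
- move=> i j ji iq; rewrite face_prism_lt // -scaleNr; congr (_ *: _).
  by case: i ji iq => // i _ _; rewrite addSn exprS mulN1r.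
- move=> i j ij jq; rewrite face_prism_gt // -scaleNr; congr (_ *: _).
  by rewrite addnS exprS mulN1r.
- by move=> i iq; rewrite face_prism_diag // addnn -mul2n exprM sqrrN expr1n
    expr1n scale1r.
- move=> i iq; rewrite face_prism_diagS // addnS addnn -mul2n exprS exprM.
  by rewrite sqrrN expr1n expr1n mulr1 scaleN1r.
Qed.

End Prism.
End Pullback.

Section CochainClosure.
Variables (K : fieldType) (X : Type) (U : set (set X)) (q : nat).
Implicit Types (c e : cochain K U q) (k : K).

Lemma cocycles0 : cocycles (0 : cochain K U q).
Proof. exact: linear0. Qed.

Lemma cocyclesD c e : cocycles c -> cocycles e -> cocycles (c + e).
Proof.
by rewrite /cocycles /= => dc de; rewrite linearD /= dc de addr0.
Qed.

Lemma cocyclesZ k c : cocycles c -> cocycles (k *: c).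
Proof. by rewrite /cocycles /= => dc; rewrite linearZ /= dc scaler0. Qed.

Lemma coboundaries0 : coboundaries (0 : cochain K U q).
Proof. by case: q => //= r; exists 0 => //; exact: linear0. Qed.

Lemma coboundariesD c e :
  coboundaries c -> coboundaries e -> coboundaries (c + e).
Proof.
case: q c e => [|r] c e /=; first by move=> -> ->; rewrite addr0.
by move=> [b _ <-] [b' _ <-]; exists (b + b') => //; rewrite linearD.
Qed.

Lemma coboundariesZ k c : coboundaries c -> coboundaries (k *: c).
Proof.
case: q c => [|r] c /=; first by move=> ->; rewrite scaler0.
by move=> [b _ <-]; exists (k *: b) => //; rewrite linearZ.
Qed.

Lemma coboundariesN c : coboundaries c -> coboundaries (- c).
Proof. by rewrite -scaleN1r; exact: coboundariesZ. Qed.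

Lemma coboundariesB c e :
  coboundaries c -> coboundaries e -> coboundaries (c - e).
Proof. by move=> Bc Be; apply/coboundariesD/coboundariesN. Qed.

End CochainClosure.

Section VertexMaps.

Lemma vertex_map_ex (X Y : Type) (f : X -> Y) (V : set (set X))
    (U : set (set Y)) :
  (forall A, V A -> exists2 B, U B & A `<=` f @^-1` B) ->
  exists p, vertex_map f p V U.
Proof.
move=> VU; have /choice[p hp] : forall A, exists B, V A -> U B /\ A `<=` f @^-1` B.
  move=> A; have [VA|nVA] := pselect (V A); last by exists set0.
  by have [B UB AB] := VU _ VA; exists B.
by exists p => A VA; exact: hp.
Qed.

Lemma vertex_map_id (X : Type) (V : set (set X)) : vertex_map id id V V.
Proof. by move=> A VA; split. Qed.

Lemma vertex_map_comp (X Y : Type) (f : X -> Y) p g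
    (V W : set (set X)) (U : set (set Y)) :
  vertex_map id p V W -> vertex_map f g W U -> vertex_map f (g \o p) V U.
Proof.
move=> hp hg A VA; have [WpA AW] := hp A VA; have [UgA Af] := hg _ WpA.
by split=> // x /AW/Af.
Qed.

Lemma vertex_map_compr (X Y : Type) (f : X -> Y) p g
    (V : set (set X)) (U T : set (set Y)) :
  vertex_map f p V U -> vertex_map id g U T -> vertex_map f (g \o p) V T.
Proof.
move=> hp hg A VA; have [UpA Af] := hp A VA; have [TgA AT] := hg _ UpA.
by split=> // x /Af/AT.
Qed.

Lemma pullback_id (K : fieldType) (X : Type) (V : set (set X)) q
    (c : cochain K V q) (h : vertex_map id id V V) : pullback h c = c.
Proof.
by apply/funext => s; rewrite /pullback /=; congr c; exact: simplex_eq.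
Qed.

Lemma pullback_comp (K : fieldType) (X Y : Type) (f : X -> Y) p g
    (V W : set (set X)) (U : set (set Y)) q (c : cochain K U q)
    (hp : vertex_map id p V W) (hg : vertex_map f g W U) :
  pullback (vertex_map_comp hp hg) c = pullback hp (pullback hg c).
Proof.
by apply/funext => s; rewrite /pullback /=; congr c; exact: simplex_eq.
Qed.

Lemma pullback_compr (K : fieldType) (X Y : Type) (f : X -> Y) p g
    (V : set (set X)) (U T : set (set Y)) q (c : cochain K T q)
    (hp : vertex_map f p V U) (hg : vertex_map id g U T) :
  pullback (vertex_map_compr hp hg) c = pullback hp (pullback hg c).
Proof.
by apply/funext => s; rewrite /pullback /=; congr c; exact: simplex_eq.
Qed.

End VertexMaps.

Definition cover_join (X : Type) (U V : set (set X)) : set (set X) :=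
  [set A `&` B | A in U & B in V].

Definition cover_preimage (X Y : Type) (f : X -> Y) (U : set (set Y)) :
    set (set X) :=
  [set f @^-1` A | A in U].

Section OpenCovers.
Variables X : topologicalType.

Lemma coverP (U : open_cover X) x : exists2 A, members U A & A x.
Proof.
have : [set: X] x by [].
by rewrite -(members_cover U) => -[A UA Ax]; exists A.
Qed.

Lemma trivial_cover_proof : \bigcup_(A in [set [set: X]]) A = [set: X].
Proof. exact: bigcup_set1. Qed.

Lemma trivial_open_proof (A : set X) : [set [set: X]] A -> open A.
Proof. by move=> ->; exact: openT. Qed.

Definition trivial_cover : open_cover X :=
  OpenCover trivial_open_proof trivial_cover_proof.

Lemma join_open_proof (U V : open_cover X) A : cover_join U V A -> open A.
Proof.
move=> [B UB [C VC <-]].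
by apply: openI; [exact: open_members UB|exact: open_members VC].
Qed.

Lemma join_cover_proof (U V : open_cover X) :
  \bigcup_(A in cover_join U V) A = [set: X].
Proof.
apply/seteqP; split=> // x _.
have [A UA Ax] := coverP U x; have [B VB Bx] := coverP V x.
by exists (A `&` B) => //; exists A => //; exists B.
Qed.

Definition open_cover_join (U V : open_cover X) : open_cover X :=
  OpenCover (@join_open_proof U V) (join_cover_proof U V).

Lemma join_projl (U V : open_cover X) :
  exists p, vertex_map id p (open_cover_join U V) U.
Proof.
by apply: vertex_map_ex => A [B UB [C VC <-]]; exists B => // x [].
Qed.

Lemma join_projr (U V : open_cover X) :
  exists p, vertex_map id p (open_cover_join U V) V.
Proof.
by apply: vertex_map_ex => A [B UB [C VC <-]]; exists C => // x [].
Qed.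

End OpenCovers.

Section Preimage.
Variables (X Y : topologicalType) (f : X -> Y) (cf : continuous f).

Lemma preimage_open_proof (U : open_cover Y) A :
  cover_preimage f U A -> open A.
Proof.
move=> [B UB <-]; apply: open_comp; first by move=> x _; exact: cf.
exact: open_members UB.
Qed.

Lemma preimage_cover_proof (U : open_cover Y) :
  \bigcup_(A in cover_preimage f U) A = [set: X].
Proof.
apply/seteqP; split=> // x _; have [A UA Ax] := coverP U (f x).
by exists (f @^-1` A) => //; exists A.
Qed.

Definition open_cover_preimage (U : open_cover Y) : open_cover X :=
  OpenCover (@preimage_open_proof U) (preimage_cover_proof U).

Lemma preimage_vertex_map (U : open_cover Y) :
  exists p, vertex_map f p (open_cover_preimage U) U.
Proof. by apply: vertex_map_ex => A [B UB <-]; exists B. Qed.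

End Preimage.

Record cech_cocycle (K : fieldType) (X : topologicalType) (q : nat) :=
  CechCocycle {
    cocycle_cover : open_cover X;
    cocycle_cochain : cochain K cocycle_cover q;
    cocycleP : cocycles cocycle_cochain }.
Arguments CechCocycle {K X q} cocycle_cover cocycle_cochain cocycleP.
Arguments cocycle_cover {K X q} c.
Arguments cocycle_cochain {K X q} c.
Arguments cocycleP {K X q} c.

HB.instance Definition _ K X q := gen_eqMixin (cech_cocycle K X q).
HB.instance Definition _ K X q := gen_choiceMixin (cech_cocycle K X q).

(* Equality in the direct limit of the H^q(N(U)): the classes agree after
   pulling back to the nerve of a common refinement.  By
   [pullback_contiguous] the choice of the projections is immaterial. *)
Definition cohomologous (K : fieldType) (X : topologicalType) (q : nat)
    (a b : cech_cocycle K X q) : Prop :=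
  exists (W : open_cover X) (p g : set X -> set X)
    (hp : vertex_map id p W (cocycle_cover a))
    (hg : vertex_map id g W (cocycle_cover b)),
    coboundaries
      (pullback hp (cocycle_cochain a) - pullback hg (cocycle_cochain b)).

Section Cohomologous.
Variable (K : fieldType).

Lemma pullbackB (X Y : Type) (f : X -> Y) p V U
    (h : vertex_map f p V U) q (c e : cochain K U q) :
  pullback h (c - e) = pullback h c - pullback h e.
Proof. by []. Qed.

Lemma pullbackD (X Y : Type) (f : X -> Y) p V U
    (h : vertex_map f p V U) q (c e : cochain K U q) :
  pullback h (c + e) = pullback h c + pullback h e.
Proof. by []. Qed.

Lemma pullbackZ (X Y : Type) (f : X -> Y) p V U
    (h : vertex_map f p V U) q k (c : cochain K U q) :
  pullback h (k *: c) = k *: pullback h c.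
Proof. by []. Qed.

Lemma cohomologous_map (X Y : topologicalType) (f : X -> Y)
    (cf : continuous f) q (a b : cech_cocycle K Y q) (T : open_cover X) p g
    (hp : vertex_map f p T (cocycle_cover a))
    (hg : vertex_map f g T (cocycle_cover b)) :
  cohomologous a b ->
  exists (T' : open_cover X) t (ht : vertex_map id t T' T),
    coboundaries (pullback ht
      (pullback hp (cocycle_cochain a) - pullback hg (cocycle_cochain b))).
Proof.
move=> [W [r [s [hr [hs Brs]]]]].
pose W' := open_cover_preimage cf W.
have [w hw] : exists w, vertex_map f w W' W by exact: preimage_vertex_map.
have [t ht] := join_projl T W'; have [u hu] := join_projr T W'.
exists (open_cover_join T W'), t, ht.
have Bw := pullback_coboundaries (vertex_map_comp hu hw) Brs.
have Ba := pullback_contiguous (vertex_map_compr (vertex_map_comp hu hw) hr)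
  (vertex_map_comp ht hp) (cocycleP a).
have Bb := pullback_contiguous (vertex_map_comp ht hg)
  (vertex_map_compr (vertex_map_comp hu hw) hs) (cocycleP b).
have := coboundariesD (coboundariesD Ba Bw) Bb.
rewrite !pullbackB !pullback_compr !pullback_comp.
by rewrite !addrA !subrK.
Qed.

Lemma cohomologous_refine (X : topologicalType) q (a b : cech_cocycle K X q)
    (T : open_cover X) p g
    (hp : vertex_map id p T (cocycle_cover a))
    (hg : vertex_map id g T (cocycle_cover b)) :
  cohomologous a b ->
  exists (T' : open_cover X) t (ht : vertex_map id t T' T),
    coboundaries (pullback ht
      (pullback hp (cocycle_cochain a) - pullback hg (cocycle_cochain b))).
Proof. by apply: cohomologous_map => x; exact: cvg_id. Qed.

Variables (X : topologicalType) (q : nat).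
Implicit Types (a b c : cech_cocycle K X q).

Lemma cohomologous_refl a : cohomologous a a.
Proof.
have hid := @vertex_map_id X (cocycle_cover a).
exists (cocycle_cover a), id, id, hid, hid.
by rewrite subrr; exact: coboundaries0.
Qed.

Lemma cohomologous_sym a b : cohomologous a b -> cohomologous b a.
Proof.
move=> [W [p [g [hp [hg B]]]]]; exists W, g, p, hg, hp.
by rewrite -opprB; exact: coboundariesN.
Qed.

Lemma cohomologous_trans a b c :
  cohomologous a b -> cohomologous b c -> cohomologous a c.
Proof.
move=> [W [p [g [hp [hg B]]]]] bc.
pose T := open_cover_join W (cocycle_cover c).
have [w hw] : exists w, vertex_map id w T W by exact: join_projl.
have [u hu] : exists u, vertex_map id u T (cocycle_cover c).
  exact: join_projr.
have [T' [t [ht Bbc]]] := cohomologous_refine (vertex_map_comp hw hg) hu bc.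
exists T', _, _, (vertex_map_comp ht (vertex_map_comp hw hp)),
  (vertex_map_comp ht hu).
have Bab := pullback_coboundaries (vertex_map_comp ht hw) B.
have := coboundariesD Bab Bbc; rewrite !pullbackB.
rewrite !pullback_comp.
by rewrite addrA subrK.
Qed.

Definition cohomologousb : rel (cech_cocycle K X q) :=
  fun a b => `[< cohomologous a b >].

Lemma cohomologousb_equiv : equiv_class_of cohomologousb.
Proof.
split=> [a|a b|b a c].
- exact/asboolP/cohomologous_refl.
- by apply/asboolP/asboolP; exact: cohomologous_sym.
- by move=> /asboolP ab /asboolP bc; exact/asboolP/(cohomologous_trans ab bc).
Qed.

Canonical cohomologous_equiv := EquivRelPack cohomologousb_equiv.

End Cohomologous.

Definition cech (K : fieldType) (X : topologicalType) (q : nat) :=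
  {eq_quot @cohomologousb K X q}.

Section CechModule.
Variables (K : fieldType) (X : topologicalType) (q : nat).
Local Notation H := (cech K X q).

HB.instance Definition _ := Choice.on H.
HB.instance Definition _ := EqQuotient.on H.

Definition cech_class (W : open_cover X) (c : cochain K W q)
  (dc : cocycles c) : H := \pi_H (CechCocycle W c dc).

Lemma cech_classP (W V : open_cover X) (c : cochain K W q) (e : cochain K V q)
    (dc : cocycles c) (de : cocycles e) :
  cech_class dc = cech_class de <->
  cohomologous (CechCocycle W c dc) (CechCocycle V e de).
Proof.
rewrite /cech_class; split=> [/eqP|ce].
  by rewrite eqmodE => /asboolP.
by apply/eqP; rewrite eqmodE; exact/asboolP.
Qed.

Lemma cech_repr (x : H) :
  x = cech_class (cocycleP (repr x)).
Proof. by rewrite /cech_class; case: (repr x) (reprK x). Qed.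

Lemma cech_class_repr (W : open_cover X) (c : cochain K W q) (dc : cocycles c) :
  cohomologous (repr (cech_class dc)) (CechCocycle W c dc).
Proof.
apply/asboolP; rewrite -[asbool _]/(cohomologousb _ _).
by rewrite -(eqmodE (@cohomologous_equiv K X q)) reprK.
Qed.

Lemma cech_class_eq (W : open_cover X) (c e : cochain K W q) (dc : cocycles c)
  (de : cocycles e) : c = e -> cech_class dc = cech_class de.
Proof. by move=> ce; subst e; congr cech_class; exact: Prop_irrelevance. Qed.

Lemma cech_class_pullback (W V : open_cover X) (c : cochain K W q) (dc : cocycles c) p
    (hp : vertex_map id p V W) :
  cech_class dc = cech_class (pullback_cocycle hp dc).
Proof.
apply/cech_classP; exists V, p, id, hp, (@vertex_map_id X V) => /=.
by rewrite pullback_id subrr; exact: coboundaries0.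
Qed.

Definition cech_zero : H :=
  cech_class (@cocycles0 K X (trivial_cover X) q).

Definition cech_scale (k : K) (x : H) : H :=
  cech_class (cocyclesZ k (cocycleP (repr x))).

Definition cech_add (x y : H) : H :=
  let hl := svalP (cid (join_projl (cocycle_cover (repr x))
                                    (cocycle_cover (repr y)))) in
  let hr := svalP (cid (join_projr (cocycle_cover (repr x))
                                    (cocycle_cover (repr y)))) in
  cech_class (cocyclesD (pullback_cocycle hl (cocycleP (repr x)))
                        (pullback_cocycle hr (cocycleP (repr y)))).

Lemma cech_zeroE (W : open_cover X) : cech_zero = cech_class (@cocycles0 K X W q).
Proof.
have [p hp] : exists p, vertex_map id p W (trivial_cover X).
  by apply: vertex_map_ex => A _; exists setT.
rewrite /cech_zero (cech_class_pullback _ hp); exact: cech_class_eq.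
Qed.

Lemma cech_scaleE k (W : open_cover X) (c : cochain K W q) (dc : cocycles c) :
  cech_scale k (cech_class dc) = cech_class (cocyclesZ k dc).
Proof.
apply/cech_classP.
have [T [p [g [hp [hg B]]]]] := cech_class_repr dc.
exists T, p, g, hp, hg => /=; rewrite !pullbackZ -scalerBr.
exact: coboundariesZ.
Qed.

Lemma cech_addE (W : open_cover X) (c e : cochain K W q) (dc : cocycles c) (de : cocycles e) :
  cech_add (cech_class dc) (cech_class de) = cech_class (cocyclesD dc de).
Proof.
rewrite /cech_add.
move: (svalP _) => hl; move: (svalP _) => hr.
apply/cech_classP.
set x := repr _ in hl hr *; set y := repr _ in hl hr *.
have xc : cohomologous x (CechCocycle W c dc) by exact: cech_class_repr.
have ye : cohomologous y (CechCocycle W e de) by exact: cech_class_repr.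
set J := open_cover_join _ _ in hl hr *.
pose T := open_cover_join J W.
have [m hm] : exists m, vertex_map id m T J by exact: join_projl.
have [w hw] : exists w, vertex_map id w T W by exact: join_projr.
have [T1 [t1 [ht1 B1]]] := @cohomologous_refine _ _ _ _ (CechCocycle W c dc)
  _ _ _ (vertex_map_comp hm hl) hw xc.
have [T2 [t2 [ht2 B2]]] := @cohomologous_refine _ _ _ _ (CechCocycle W e de)
  _ _ _ (vertex_map_comp ht1 (vertex_map_comp hm hr)) (vertex_map_comp ht1 hw) ye.
exists T2, _, _, (vertex_map_comp ht2 (vertex_map_comp ht1 hm)),
  (vertex_map_comp ht2 (vertex_map_comp ht1 hw)).
have := coboundariesD (pullback_coboundaries ht2 B1) B2.
rewrite /= !pullbackB !pullbackD.
rewrite !pullback_comp.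
by rewrite opprD addrACA.
Qed.

Lemma cech_common2 (x y : H) :
  exists (W : open_cover X) (a b : cochain K W q) (da : cocycles a)
    (db : cocycles b), x = cech_class da /\ y = cech_class db.
Proof.
rewrite (cech_repr x) (cech_repr y).
set U := cocycle_cover (repr x); set V := cocycle_cover (repr y).
have [p hp] := join_projl U V; have [g hg] := join_projr U V.
exists (open_cover_join U V), _, _, (pullback_cocycle hp (cocycleP (repr x))),
  (pullback_cocycle hg (cocycleP (repr y))).
by split; exact: cech_class_pullback.
Qed.

Lemma cech_common3 (x y z : H) :
  exists (W : open_cover X) (a b c : cochain K W q) (da : cocycles a)
    (db : cocycles b) (dc : cocycles c),
    [/\ x = cech_class da, y = cech_class db & z = cech_class dc].
Proof.
have [U [a [b [da [db [-> ->]]]]]] := cech_common2 x y.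
rewrite (cech_repr z); set V := cocycle_cover (repr z).
have [p hp] := join_projl U V; have [g hg] := join_projr U V.
exists (open_cover_join U V), _, _, _, (pullback_cocycle hp da),
  (pullback_cocycle hp db), (pullback_cocycle hg (cocycleP (repr z))).
by split; exact: cech_class_pullback.
Qed.

Lemma cech_addA : associative cech_add.
Proof.
move=> x y z; have [W [a [b [c [da [db [dc [-> -> ->]]]]]]]] :=
  cech_common3 x y z.
by rewrite !cech_addE; apply: cech_class_eq; exact: addrA.
Qed.

Lemma cech_addC : commutative cech_add.
Proof.
move=> x y; have [W [a [b [da [db [-> ->]]]]]] := cech_common2 x y.
by rewrite !cech_addE; apply: cech_class_eq; exact: addrC.
Qed.

Lemma cech_add0 : left_id cech_zero cech_add.
Proof.
move=> x; rewrite (cech_repr x) (cech_zeroE (cocycle_cover (repr x))).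
by rewrite cech_addE; apply: cech_class_eq; exact: add0r.
Qed.

Lemma cech_addN : left_inverse cech_zero (cech_scale (-1)) cech_add.
Proof.
move=> x; rewrite (cech_repr x) (cech_zeroE (cocycle_cover (repr x))).
by rewrite cech_scaleE cech_addE; apply: cech_class_eq; rewrite scaleN1r addNr.
Qed.

HB.instance Definition _ :=
  GRing.isZmodule.Build H cech_addA cech_addC cech_add0 cech_addN.

Lemma cech_scaleA k l (x : H) :
  cech_scale k (cech_scale l x) = cech_scale (k * l) x.
Proof.
by rewrite (cech_repr x) !cech_scaleE; apply: cech_class_eq; exact: scalerA.
Qed.

Lemma cech_scale1 : left_id 1 cech_scale.
Proof.
move=> x; rewrite [RHS](cech_repr x) [in LHS](cech_repr x) cech_scaleE.
by apply: cech_class_eq; exact: scale1r.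
Qed.

Lemma cech_scaleDr : right_distributive cech_scale +%R.
Proof.
move=> k x y; have [W [a [b [da [db [-> ->]]]]]] := cech_common2 x y.
rewrite -[_ + _]/(cech_add _ _) -[RHS]/(cech_add _ _).
rewrite cech_addE !cech_scaleE cech_addE.
by apply: cech_class_eq; exact: scalerDr.
Qed.

Lemma cech_scaleDl (x : H) : {morph cech_scale^~ x : k l / k + l}.
Proof.
move=> k l; rewrite (cech_repr x) -[RHS]/(cech_add _ _).
rewrite !cech_scaleE cech_addE.
by apply: cech_class_eq; exact: scalerDl.
Qed.

HB.instance Definition _ := GRing.Zmodule_isLmodule.Build K H
  cech_scaleA cech_scale1 cech_scaleDr cech_scaleDl.

End CechModule.

Section CechMap.
Variables (K : fieldType) (X Y : topologicalType) (f : X -> Y).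
Variables (cf : continuous f) (q : nat).

Definition cech_map (x : cech K Y q) : cech K X q :=
  let h := svalP (cid (preimage_vertex_map cf (cocycle_cover (repr x)))) in
  cech_class (pullback_cocycle h (cocycleP (repr x))).

Lemma cech_mapE (W : open_cover X) (U : open_cover Y) (c : cochain K U q)
    (dc : cocycles c) p (hp : vertex_map f p W U) :
  cech_map (cech_class dc) = cech_class (pullback_cocycle hp dc).
Proof.
rewrite /cech_map; move: (svalP _) => hr; apply/cech_classP.
set x := repr _ in hr *.
have xc : cohomologous x (CechCocycle U c dc) by exact: cech_class_repr.
set V := open_cover_preimage _ _ in hr *.
have [l hl] := join_projl V W; have [s hs] := join_projr V W.
have [T [t [ht B]]] := cohomologous_map cf
  (vertex_map_comp hl hr : vertex_map f _ _ _)
  (vertex_map_comp hs hp : vertex_map f _ _ (cocycle_cover (CechCocycle U c dc)))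
  xc.
exists T, _, _, (vertex_map_comp ht hl), (vertex_map_comp ht hs).
move: B; rewrite /= !pullbackB.
by rewrite !pullback_comp.
Qed.

Lemma cech_map_is_linear : linear cech_map.
Proof.
move=> k x y; have [U [a [b [da [db [-> ->]]]]]] := cech_common2 x y.
have [p hp] := preimage_vertex_map cf U.
rewrite -[k *: _ + _]/(cech_add (cech_scale k _) _).
rewrite cech_scaleE cech_addE !(cech_mapE _ hp).
rewrite -[RHS]/(cech_add (cech_scale k _) _) cech_scaleE cech_addE.
exact: cech_class_eq.
Qed.

HB.instance Definition _ := @GRing.isLinear.Build K (cech K Y q) (cech K X q)
  _ cech_map cech_map_is_linear.

End CechMap.
Arguments cech_map K {X Y f} cf q x.

Definition is_eigenvalue (K : fieldType) (M : lmodType K)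
    (g : {linear M -> M}) (a : K) : Prop :=
  exists2 v : M, v != 0 & g v = a *: v.

Definition locally_connected (X : topologicalType) : Prop :=
  forall (x : X) (A : set X), nbhs x A ->
    exists B : set X, [/\ open B, connected B, B x & B `<=` A].

Definition has_subcover_of_card (X : Type) (U : set (set X)) (n : nat) : Prop :=
  exists D : set (set X),
    [/\ D `<=` U, \bigcup_(A in D) A = [set: X] & D #= `I_n]%card.

(* The value 0 when U has no finite subcover is never used for the open
   covers of a compact space. *)
Definition min_subcover_card (X : Type) (U : set (set X)) : nat :=
  if pselect (exists n, `[< has_subcover_of_card U n >]) is left exn
  then ex_minn exn else 0%N.

(* The join of U, f^-1(U), ..., f^-n(U): n + 1 factors, and U itself at
   n = 0. *)
Fixpoint iterated_join (X : Type) (f : X -> X) (U : set (set X)) (n : nat) :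
    set (set X) :=
  match n with
  | 0 => U
  | m.+1 => cover_join (iterated_join f U m) (cover_preimage (iter m.+1 f) U)
  end.

Definition cover_entropy (R : realType) (X : Type) (f : X -> X)
    (U : set (set X)) : R :=
  limn (fun n : nat =>
    ln (min_subcover_card (iterated_join f U n))%:R / n%:R : R).

Definition topological_entropy (R : realType) (X : topologicalType)
    (f : X -> X) : \bar R :=
  ereal_sup [set (cover_entropy R f U)%:E | U in [set: open_cover X]].

(* Main.v *)
Require Import Defs.
From HB Require Import structures.
From mathcomp Require Import all_boot all_order all_algebra.
From mathcomp Require Import finmap complex zify ring lra.
From mathcomp Require Import all_classical all_reals all_analysis.

(** The idea is that the eigenclass has a multivalued primitive which [f]
expands by [lambda].

Let the class be represented by a cocycle [c] on a cover.  On a fine enough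
cover [V] the equation f^* c = lambda c holds up to the coboundary of a
function [b], and since [X] is compact and locally connected [V] can be taken
finite with connected members ([finite_connected_refinement]).  Choose for each
point [x] a member [a x] of [V] containing it.  The functions
[x |-> c A (a x)], one for each member [A] of [V], are primitives of [c]: on
the overlap of [A] and [B] they differ by the constant [c A B].  They satisfy
the eigenvalue equation up to a bounded error [beta].  As [|lambda| > 1], the
equation [lambda * G = beta + G \o f] has a bounded solution [G], namely the
sum of the [lambda ^- i.+1 * beta (f^i x)] ([cohomological_equation]), and adding
[G] to the primitives removes the error.  This gives bounded functions [F A]
on the members [A] of [V], such that [F A - F B] is the constant [c A B] on
the overlap of [A] and [B] and [lambda * F A - F B \o f] is constant wherever
it makes sense ([local_primitives]).

Iterating the last property, two points in a common member of
V \/ f^-1 V \/ ... \/ f^-n V have values of [F A] at distance at most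
[2 M / |lambda| ^ n], where [M] bounds the primitives
([iterated_join_contract]).  A minimal subcover of this join has [s_n]
members.  Any two points of the connected set [A] are linked inside [A] by a
chain running through each of these members at most once, so [F A] varies by
at most [2 M s_n / |lambda| ^ n] on [A] ([connected_oscillation]).

If some [F A] is not constant on [A], this forces [s_n] to grow at least like
[|lambda| ^ n], so the entropy of [V] is at least [ln |lambda|]
([nonconstant_entropy], [cover_entropy_ge]).  Otherwise [F] is a function of
[A] alone, and [c A B = F A - F B] shows that the class is zero. *)

Import Order.TTheory GRing.Theory Num.Theory.
Import numFieldNormedType.Exports.

Set Implicit Arguments.
Unset Strict Implicit.
Unset Printing Implicit Defensive.

Local Open Scope classical_set_scope.
Local Open Scope ring_scope.
Local Open Scope complex_scope.

(** * The equation lambda G = beta + G o f *)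

Section ComplexModulus.
Variable R : realType.
Implicit Types z w : R[i].

Lemma normc_ge0 z : 0 <= Normc.normc z.
Proof. by case: z => a b; exact: sqrtr_ge0. Qed.

Lemma normc_opp z : Normc.normc (- z) = Normc.normc z.
Proof. exact: (@complex.normcN R z). Qed.

Lemma normcX z n : Normc.normc (z ^+ n) = Normc.normc z ^+ n.
Proof.
elim: n => [|n IH]; first by rewrite !expr0 Normc.normc1.
by rewrite !exprS Normc.normcM IH.
Qed.

Lemma normcD_le z w : Normc.normc (z + w) <= Normc.normc z + Normc.normc w.
Proof. exact: (@complex.le_normcD R z w). Qed.

Lemma normcB_le z w : Normc.normc (z - w) <= Normc.normc z + Normc.normc w.
Proof. by rewrite -(normc_opp w); exact: normcD_le. Qed.

Lemma normc_Re_le z : `|complex.Re z| <= Normc.normc z.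
Proof. by case: z => a b /=; rewrite -sqrtr_sqr ler_wsqrtr // lerDl sqr_ge0. Qed.

Lemma normc_Im_le z : `|complex.Im z| <= Normc.normc z.
Proof. by case: z => a b /=; rewrite -sqrtr_sqr ler_wsqrtr // lerDr sqr_ge0. Qed.

Lemma normc_le_ReIm z : Normc.normc z <= `|complex.Re z| + `|complex.Im z|.
Proof.
case: z => a b /=; rewrite -(ler_sqr (x := Num.sqrt _)) ?nnegrE ?sqrtr_ge0 ?addr_ge0 //.
rewrite sqr_sqrtr ?addr_ge0 ?sqr_ge0 // sqrrD !real_normK ?num_real //.
by rewrite -addrA lerD2l lerDr mulrn_wge0 // mulr_ge0.
Qed.

(** The intervals [S n - e n, S n + e n] are nested, so they have a common
point. *)
Lemma nested_limit (S e : nat -> R) : (forall n, 0 <= e n) ->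
  (forall n, `|S n.+1 - S n| <= e n - e n.+1) ->
  exists L, forall n, `|L - S n| <= e n.
Proof.
move=> e0 Se.
have lo m k : S m - e m <= S (m + k)%N - e (m + k)%N.
  elim: k => [|k IH]; first by rewrite addn0.
  apply: le_trans IH _; rewrite addnS.
  by have := Se (m + k)%N; rewrite ler_norml => /andP[]; lra.
have hi m k : S (m + k)%N + e (m + k)%N <= S m + e m.
  elim: k => [|k IH]; first by rewrite addn0.
  apply: le_trans IH; rewrite addnS.
  by have := Se (m + k)%N; rewrite ler_norml => /andP[]; lra.
have ub n : ubound (range (fun m => S m - e m)) (S n + e n).
  move=> _ [m _ <-]; have := lo m n; have := hi n m; rewrite addnC.
  by have := e0 (m + n)%N; lra.
have hs : has_sup (range (fun m => S m - e m)).
  by split; [exists (S 0%N - e 0%N); exists 0%N|exists (S 0%N + e 0%N)].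
exists (sup (range (fun m => S m - e m))) => n.
have h1 : sup (range (fun m => S m - e m)) <= S n + e n.
  by apply: ge_sup => //; exact: hs.1.
have h2 : S n - e n <= sup (range (fun m => S m - e m)).
  by apply: ub_le_sup; [exact: hs.2|exists n].
by rewrite ler_norml; apply/andP; split; lra.
Qed.

(** The factor 2 comes from treating real and imaginary parts separately. *)
Lemma nested_limitC (S : nat -> R[i]) (e : nat -> R) : (forall n, 0 <= e n) ->
  (forall n, Normc.normc (S n.+1 - S n) <= e n - e n.+1) ->
  exists L, forall n, Normc.normc (L - S n) <= e n *+ 2.
Proof.
move=> e0 Se.
have [a aS] : exists a, forall n, `|a - complex.Re (S n)| <= e n.
  apply: nested_limit => // n; apply: le_trans (Se n).
  by rewrite -raddfB; exact: normc_Re_le.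
have [b bS] : exists b, forall n, `|b - complex.Im (S n)| <= e n.
  apply: nested_limit => // n; apply: le_trans (Se n).
  by rewrite -raddfB; exact: normc_Im_le.
exists (a +i* b) => n; apply: le_trans (normc_le_ReIm _) _.
by rewrite !raddfB /= mulr2n lerD.
Qed.

(** Bernoulli's inequality makes [k ^+ n] unbounded. *)
Lemma geometric_small (a k : R) : 1 < k -> (forall n, a * k ^+ n <= 1) -> a <= 0.
Proof.
move=> k1 ak; rewrite leNgt; apply/negP => a0.
have [n] : exists n, a^-1 < k ^+ n.
  have [n nP] : exists n : nat, a^-1 / (k - 1) < n%:R.
    by exists (Num.truncn (a^-1 / (k - 1))).+1; rewrite truncnS_gt.
  exists n; have : 1 + (k - 1) *+ n <= k ^+ n.
    elim: n {nP} => [|n IH]; first by rewrite mulr0n addr0 expr0.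
    rewrite exprS mulrSr; move: IH; set p := _ *+ n; set q := k ^+ n => IH.
    have : 0 <= p by rewrite mulrn_wge0 // subr_ge0 ltW.
    by nra.
  move: nP; rewrite ltr_pdivrMr ?subr_gt0 // mulr_natl.
  by move=> h1 h2; apply: lt_le_trans h2; apply: lt_trans h1 _; rewrite ltrDr.
by rewrite ltNge -[a^-1]mulr1 ler_pdivlMl ?ak.
Qed.

(** The solution is the sum of [beta (f^i x) / lambda ^+ i.+1], whose partial
sums [S x n] are controlled by a geometric series.  Both sides of the equation
are approximated by partial sums with an error that tends to zero. *)
Lemma cohomological_equation (X : Type) (f : X -> X) (lambda : R[i])
    (beta : X -> R[i]) (C : R) :
  1 < Normc.normc lambda -> (forall x, Normc.normc (beta x) <= C) ->
  exists (G : X -> R[i]) (M : R),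
    (forall x, Normc.normc (G x) <= M) /\
    (forall x, lambda * G x = beta x + G (f x)).
Proof.
set k := Normc.normc lambda => k1 bC.
have k0 : 0 < k by rewrite (lt_trans _ k1).
have l0 : lambda != 0.
  by apply/eqP => l0; move: k0; rewrite /k l0 Normc.normc0 ltxx.
pose S x n := \sum_(i < n) beta (iter i f x) / lambda ^+ i.+1.
(* [e n] is the tail of the series [`|C| / k ^+ i.+1] from [i = n] on. *)
pose e n := `|C| / (k - 1) / k ^+ n.
have SS x n : S x n.+1 = (beta x + S (f x) n) / lambda.
  rewrite /S big_ord_recl /= expr1 mulrDl mulr_suml; congr (_ + _).
  apply: eq_bigr => i _; rewrite -iterS iterSr [in LHS]exprS.
  by rewrite invfM mulrCA mulrC.
have [G GS] : exists G : X -> R[i], forall x n, Normc.normc (G x - S x n) <= e n *+ 2.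
  suff /choice[G GS] : forall x, exists L, forall n, Normc.normc (L - S x n) <= e n *+ 2.
    by exists G.
  move=> x; apply: nested_limitC => n.
    by rewrite !divr_ge0 ?exprn_ge0 ?subr_ge0 // ltW.
  rewrite /S big_ord_recr /= addrAC subrr add0r Normc.normcM Normc.normcV normcX -/k.
  have -> : e n - e n.+1 = `|C| / k ^+ n.+1.
    rewrite /e exprS; field.
    by rewrite expf_neq0 ?gt_eqF // subr_gt0.
  apply: ler_wpM2r; first by rewrite invr_ge0 exprn_ge0 // ltW.
  by apply: le_trans (bC _) _; exact: ler_norm.
exists G, (e 0%N *+ 2); split=> x.
  by have := GS x 0%N; rewrite /S big_ord0 subr0.
apply/eqP; rewrite -subr_eq0; apply/eqP; apply: Normc.eq0_normc.
apply/eqP; rewrite eq_le normc_ge0 andbT.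
have key n : Normc.normc (lambda * G x - (beta x + G (f x))) <= e n *+ 4.
  have -> : lambda * G x - (beta x + G (f x)) =
    lambda * (G x - S x n.+1) - (G (f x) - S (f x) n).
    by rewrite SS; field.
  apply: le_trans (normcB_le _ _) _; rewrite Normc.normcM -/k.
  have -> : e n *+ 4 = k * (e n.+1 *+ 2) + e n *+ 2.
    rewrite /e exprS; field.
    by rewrite expf_neq0 ?gt_eqF // subr_gt0.
  by apply: lerD => //; rewrite ler_pM2l.
set z := Normc.normc _ in key *.
pose D : R := (`|C| / (k - 1)) *+ 4 + 1.
have D0 : 0 < D by rewrite ltr_wpDl // mulrn_wge0 // divr_ge0 // subr_ge0 ltW.
suff : z / D <= 0 by rewrite pmulr_lle0 // invr_gt0.
apply: (geometric_small k1) => n.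
rewrite mulrAC ler_pdivrMr // mul1r -ler_pdivlMr ?exprn_gt0 //.
apply: le_trans (key n) _; rewrite /e -mulrnAl ler_pM2r ?invr_gt0 ?exprn_gt0 //.
by rewrite lerDl.
Qed.

End ComplexModulus.

(** * Subadditive sequences and the entropy of a cover *)

Section Subadditive.
Variable R : realType.

(** Fekete's lemma.  The term [a n] counts [n + 1] factors, so the subadditive
sequence in the usual sense is [n.+1 |-> a n] and the limit is the infimum of
the [a k / k.+1]. *)
Lemma subadditive_cvg (a : nat -> R) : (forall n, 0 <= a n) ->
  (forall m n, a (m + n).+1 <= a m + a n) ->
  cvgn (fun n : nat => a n / n%:R).
Proof.
move=> a0 aD.
pose m k := a k / k.+1%:R.
pose C k := \sum_(i < k.+1) a i.
(* Cut [n.+1] into blocks of length [k.+1] and a remainder of length at most [k]. *)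
have upper k n : a n <= n.+1%:R * m k + C k.
  elim/ltn_ind: n => n IH; have [nk|kn] := leqP n k.
    rewrite ler_wpDl ?mulr_ge0 ?divr_ge0 //.
    rewrite /C (bigD1 (Ordinal (nk : (n < k.+1)%N))) //= lerDl.
    exact: sumr_ge0.
  have -> : n = (k + (n - k.+1)).+1 by lia.
  set p := (n - k.+1)%N.
  apply: le_trans (aD _ _) _.
  have pn : (p < n)%N by rewrite /p; lia.
  apply: le_trans (lerD (lexx _) (IH _ pn)) _.
  rewrite addrA lerD2r.
  have -> : a k = k.+1%:R * m k by rewrite /m mulrC divfK ?pnatr_eq0.
  by rewrite -mulrDl -natrD addSn addnS.
pose L := inf (range m).
have m0 : has_inf (range m).
  split; first by exists (m 0%N); exists 0%N.
  by exists 0 => _ [k _ <-]; rewrite divr_ge0.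
have Lm k : L <= m k by apply: ge_inf; [exact: m0.2|exists k].
apply/cvg_ex; exists L; apply/cvgrPdist_le => /= e e0.
have [_ [k _ <-] mk] : exists2 y, range m y & y < L + e / 2.
  by apply: inf_adherent => //; rewrite divr_gt0.
near=> n.
have n0 : 0 < n%:R :> R by rewrite ltr0n; near: n; exists 1%N.
have ne : m k + C k <= e / 2 * n%:R.
  rewrite mulrC -ler_pdivrMr ?divr_gt0 //.
  near: n; exact: nbhs_infty_ger.
have h1 : a n / n%:R <= m k + e / 2.
  rewrite ler_pdivrMr // mulrDl; apply: le_trans (upper k n) _.
  rewrite -natr1 mulrDl mul1r -addrA mulrC lerD2l //.
have h2 : L <= a n / n%:R.
  apply: le_trans (Lm n) _; rewrite /m ler_wpM2l // lef_pV2 ?posrE //.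
  by rewrite ler_nat.
by rewrite ler_norml; apply/andP; split; lra.
Unshelve. all: by end_near. Qed.

End Subadditive.

Section SubcoverCardinality.
Variable X : Type.
Implicit Type U : set (set X).

(** An enumeration, possibly with repetitions, of a subcover: it bounds the
number of members and is easier to combine than a set of given cardinality. *)
Definition indexed_subcover U n (W : nat -> set X) :=
  (forall i, (i < n)%N -> U (W i)) /\ forall x, exists2 i, (i < n)%N & W i x.

Lemma min_subcover_card_le U n W :
  indexed_subcover U n W -> (min_subcover_card U <= n)%N.
Proof.
move=> [UW Wc].
have [m mn Um] : exists2 m, (m <= n)%N & `[< has_subcover_of_card U m >].
  have : (W @` `I_n #<= `I_n)%card by exact: card_image_le.
  have [m Dm] : exists m, (W @` `I_n #= `I_m)%card.
    by apply/finite_setP; apply: finite_image; exact: finite_II.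
  rewrite (card_le_eql Dm) card_le_II => mn; exists m => //; apply/asboolP.
  exists (W @` `I_n); split => //.
  - by move=> _ [i /= ltin <-]; exact: UW.
  - apply/seteqP; split=> // x _; have [i ltin Wx] := Wc x.
    by exists (W i) => //; exists i.
rewrite /min_subcover_card; case: pselect => [exn|]; last by case; exists m.
by case: ex_minnP => k _ kmin; exact: leq_trans (kmin m Um) mn.
Qed.

Lemma min_subcover_card_attained U : finite_set U ->
  \bigcup_(A in U) A = [set: X] ->
  exists W, indexed_subcover U (min_subcover_card U) W.
Proof.
move=> /finite_setP[n Un] Uc.
have exn : exists n, `[< has_subcover_of_card U n >].
  by exists n; apply/asboolP; exists U; split.
rewrite /min_subcover_card; case: pselect => // {}exn.
case: ex_minnP => k /asboolP[D [DU Dc Dk]] _.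
have /pcard_eqP[W] : (`I_k #= D)%card by rewrite card_eq_sym.
exists W; split=> [i ik|x]; first by apply: DU; exact: (funS (s := W)).
have : [set: X] x by [].
by rewrite -Dc => -[A /(surj (f := W))[i ik <-] Ax]; exists i.
Qed.

End SubcoverCardinality.

Section IteratedJoin.
Variables (X : Type) (f : X -> X) (U : set (set X)).

(** The join over the times 0, ..., m + n + 1 is the join over 0, ..., m
followed by the pullback under [f^(m + 1)] of the join over 0, ..., n. *)
Lemma iterated_joinD m n A B : iterated_join f U m A -> iterated_join f U n B ->
  iterated_join f U (m + n).+1 (A `&` iter m.+1 f @^-1` B).
Proof.
move=> mA; elim: n B => [|n IH] B.
  move=> UB; rewrite addn0; exists A => //.
  by exists (iter m.+1 f @^-1` B) => //; exists B.
move=> [B' nB' [_ [C UC <-] <-]]; rewrite addnS.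
exists (A `&` iter m.+1 f @^-1` B'); first exact: IH.
exists (iter (m + n).+2 f @^-1` C); first by exists C.
rewrite preimage_setI setIA; congr (_ `&` _).
apply/seteqP; split => x /=; rewrite -!iterS -iterD;
  by have -> : (n.+1 + m.+1 = (m + n).+2)%N by lia.
Qed.

Lemma iterated_join_finite n : finite_set U -> finite_set (iterated_join f U n).
Proof.
move=> Uf; elim: n => //= n IH.
have -> : cover_join (iterated_join f U n) (cover_preimage (iter n.+1 f) U) =
  (fun p => p.1 `&` p.2) @`
    (iterated_join f U n `*` cover_preimage (iter n.+1 f) U).
  apply/seteqP; split=> W.
    by move=> [A nA [B UB <-]]; exists (A, B).
  by move=> [[A B] [/= nA UB] <-]; exists A => //; exists B.
by apply: finite_image; apply: finite_setX => //; exact: finite_image.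
Qed.

End IteratedJoin.

Section CoverEntropy.
Variables (X : topologicalType) (f : X -> X) (cf : continuous f).
Variable U : open_cover X.

Lemma iterated_join_open_cover n :
  exists V : open_cover X, members V = iterated_join f U n.
Proof.
have citer m : continuous (iter m f).
  elim: m => [|m IH] x; first exact: cvg_id.
  by apply: (@continuous_comp _ _ _ (iter m f) f x); [exact: IH|exact: cf].
elim: n => [|n [V nV]]; first by exists U.
by exists (open_cover_join V (open_cover_preimage (citer n.+1) U)); rewrite /= nV.
Qed.

Lemma iterated_join_cover n : \bigcup_(A in iterated_join f U n) A = [set: X].
Proof. by have [V <-] := iterated_join_open_cover n; exact: members_cover. Qed.

Lemma iterated_join_open n A : iterated_join f U n A -> open A.
Proof. by have [V <-] := iterated_join_open_cover n; exact: open_members. Qed.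

Hypothesis finU : finite_set U.

(** Intersecting the members of two minimal subcovers, the second one pulled
back by [f^(m + 1)], gives a subcover of the longer join. *)
Lemma min_subcover_card_iterated_join m n :
  (min_subcover_card (iterated_join f U (m + n).+1) <=
   min_subcover_card (iterated_join f U m) *
   min_subcover_card (iterated_join f U n))%N.
Proof.
have [A [UA Ac]] := min_subcover_card_attained (iterated_join_finite f m finU)
  (iterated_join_cover m).
have [B [UB Bc]] := min_subcover_card_attained (iterated_join_finite f n finU)
  (iterated_join_cover n).
set s := min_subcover_card (iterated_join f U m) in UA Ac *.
set t := min_subcover_card (iterated_join f U n) in UB Bc *.
apply: (min_subcover_card_le
  (W := fun k => A (k %/ t)%N `&` iter m.+1 f @^-1` B (k %% t)%N)).
split=> [k kst|x].
  have t0 : (0 < t)%N by case: (posnP t) kst => // ->; rewrite muln0.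
  by apply: iterated_joinD; [apply: UA; rewrite ltn_divLR|apply: UB; rewrite ltn_mod].
have [i si Ai] := Ac x; have [j tj Bj] := Bc (iter m.+1 f x).
have t0 : (0 < t)%N by exact: leq_ltn_trans tj.
exists (i * t + j)%N; first by nia.
by rewrite divnMDl // divn_small // addn0 modnMDl modn_small.
Qed.

Variable R : realType.

(** A point of [X] makes the cardinalities positive, hence their logarithms
nonnegative and subadditive. *)
Lemma cover_entropy_cvg : X ->
  cvgn (fun n : nat =>
    ln (min_subcover_card (iterated_join f U n))%:R / n%:R : R).
Proof.
move=> x0.
have s0 n : (0 < min_subcover_card (iterated_join f U n))%N.
  have [W [_ /(_ x0)[i + _]]] := min_subcover_card_attained
    (iterated_join_finite f n finU) (iterated_join_cover n).
  exact: leq_ltn_trans.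
apply: subadditive_cvg => [n|m n]; first by rewrite ln_ge0 // ler1n.
rewrite -lnM ?posrE ?ltr0n //.
rewrite ler_ln ?posrE ?mulr_gt0 ?ltr0n // -natrM ler_nat.
exact: min_subcover_card_iterated_join.
Qed.

Lemma cover_entropy_ge (k e : R) : X -> 0 < k -> 0 < e ->
  (forall n, e * k ^+ n <= (min_subcover_card (iterated_join f U n))%:R) ->
  ln k <= cover_entropy R f U.
Proof.
move=> x0 k0 e0 sk; have cu := cover_entropy_cvg x0.
have : (fun n : nat => ln k + ln e / n%:R) @ \oo --> ln k + ln e * 0.
  apply: cvgD; first exact: cvg_cst.
  apply: cvgM; first exact: cvg_cst.
  by apply/gtr0_cvgV0; [near=> n; rewrite ltr0n; near: n; exists 1%N|exact: cvgr_idn].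
rewrite mulr0 addr0 => lk; rewrite -(cvg_lim _ lk) //.
apply: ler_lim => //; first by apply/cvg_ex; exists (ln k).
near=> n.
have n0 : 0 < n%:R :> R by rewrite ltr0n; near: n; exists 1%N.
rewrite ler_pdivlMr // mulrDl divfK ?gt_eqF // mulr_natr -lnXn //.
rewrite addrC -lnM ?posrE ?exprn_gt0 //.
have h := lt_le_trans (mulr_gt0 e0 (exprn_gt0 n k0)) (sk n).
by rewrite ler_ln ?posrE ?mulr_gt0 ?exprn_gt0.
Unshelve. all: by end_near. Qed.

End CoverEntropy.

(** * Connected sets and connected covers *)

Section FiniteBounds.
Variable R : realType.

Lemma finite_set_bounded (T : Type) (S : set T) (g : T -> R) :
  finite_set S -> exists C, forall x, S x -> g x <= C.
Proof.
move=> /(finite_image g)/finite_seqP[s gS].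
exists (\sum_(y <- s) `|y|) => x Sx.
have gx : g x \in s by suff : [set` s] (g x) by []; rewrite -gS; exists x.
by rewrite (big_rem _ gx) /= (le_trans (ler_norm _)) // lerDl sumr_ge0.
Qed.

Lemma finite_set_bounded2 (T : Type) (S : set T) (g : T -> T -> R) :
  finite_set S -> exists C, forall x y, S x -> S y -> g x y <= C.
Proof.
move=> Sf.
have [C gC] := finite_set_bounded (fun p => g p.1 p.2) (finite_setX Sf Sf).
by exists C => x y Sx Sy; exact: (gC (x, y) (conj Sx Sy)).
Qed.

End FiniteBounds.

Section Connectedness.
Variable X : topologicalType.

(** A chain argument: [A] is connected, so any two of its points are joined
by a chain of the [W i] whose consecutive members meet inside [A], and a
shortest chain uses each [W i] once.  Instead of handling chains, the proof
takes a largest set [T] of indices for which the bound [e *+ #|T|] holds on the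
part of [A] covered by [T]; that part is then open and closed in [A]. *)
Lemma connected_oscillation (R : realType) (A : set X) n (W : nat -> set X)
    (F : X -> R[i]) (e : R) :
  connected A ->
  (forall i, (i < n)%N -> open (W i)) ->
  (forall x, exists2 i, (i < n)%N & W i x) ->
  (forall i x y, (i < n)%N -> A x -> A y -> W i x -> W i y ->
    Normc.normc (F x - F y) <= e) ->
  forall x y, A x -> A y -> Normc.normc (F x - F y) <= e *+ n.
Proof.
move=> conA openW coverW We x y Ax Ay.
have [i0 i0n Wi0x] := coverW x.
have e0 : 0 <= e.
  by apply: le_trans (We _ _ _ i0n Ax Ax Wi0x Wi0x); rewrite subrr Normc.normc0.
pose P (T : {set 'I_n}) := (exists2 i, i \in T & W i x) /\
  forall z i, A z -> i \in T -> W i z -> Normc.normc (F x - F z) <= e *+ #|T|.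
have P0 : P [set Ordinal i0n]%SET.
  split; first by exists (Ordinal i0n); rewrite ?inE.
  by move=> z i Az; rewrite inE => /eqP -> Wz; rewrite cards1 mulr1n; apply: We Wz.
have [T PT maxT] : exists2 T, P T & forall T', P T' -> (#|T'| <= #|T|)%N.
  have := @arg_maxnP _ ([set Ordinal i0n]%SET : {set 'I_n})
    (fun T => `[< P T >]) (fun T => #|T|).
  move=> /(_ (asboolT P0))[T /asboolP PT maxT].
  by exists T => // T' PT'; apply: maxT; exact/asboolP.
(* A member meeting the part covered by [T] could be added to [T]. *)
have apart z (i j : 'I_n) : A z -> i \in T -> W i z -> W j z -> j \in T.
  move=> Az iT Wiz Wjz; apply: contraT => jT.
  suff /maxT : P (j |: T)%SET by rewrite cardsU1 jT add1n ltnn.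
  split; first by case: PT => -[k kT Wkx] _; exists k => //; rewrite !inE kT orbT.
  move=> w k Aw; rewrite cardsU1 jT add1n mulrSr => /setU1P[->|kT] Wkw.
    have -> : F x - F w = (F x - F z) + (F z - F w) by rewrite addrA subrK.
    apply: le_trans (normcD_le _ _) _; apply: lerD; first exact: (PT.2 z i).
    exact: (We j).
  by apply: le_trans (PT.2 w k Aw kT Wkw) _; rewrite lerDl.
(* By [apart], this part is the complement in [A] of the other members. *)
have AT : A `&` \bigcup_(i in [set i | i \in T]) W i = A.
  apply: conA.
  - by case: PT => -[k kT Wkx] _; exists x; split=> //; exists k.
  - exists (\bigcup_(i in [set i | i \in T]) W i) => //.
    by apply: bigcup_open => i _; exact: openW.
  - exists (~` \bigcup_(i in [set i | i \notin T]) W i).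
      by apply: open_closedC; apply: bigcup_open => i _; exact: openW.
    apply/seteqP; split=> z [Az].
      move=> [i iT Wiz]; split=> // -[j /= jT Wjz].
      by move: jT; rewrite (apart z i).
    move=> nWz; split=> //; have [i ltin Wiz] := coverW z.
    exists (Ordinal ltin) => //=; apply: contraT => iT.
    by exfalso; apply: nWz; exists (Ordinal ltin).
have : (A `&` \bigcup_(i in [set i | i \in T]) W i) y by rewrite AT.
move=> [_ [i iT Wiy]]; apply: le_trans (PT.2 y i Ay iT Wiy) _.
by rewrite ler_wpMn2l // -[leqRHS]card_ord max_card.
Qed.

(** The connected open sets contained in some member of [U] cover [X], by
local connectedness; compactness extracts a finite cover. *)
Lemma finite_connected_refinement (U : open_cover X) :
  X -> compact [set: X] -> locally_connected X ->
  exists V : open_cover X, [/\ finite_set V, forall A, members V A -> connected A &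
    forall A, members V A -> exists2 B, members U B & A `<=` B].
Proof.
move=> x0 cptX lcX.
(* [compact_cover] speaks of pointed spaces; [x0] is the point. *)
pose pX : ptopologicalType := HB.pack X (isPointed.Build X x0).
have {}cptX : cover_compact [set: X].
  by have : @cover_compact pX [set: X] by rewrite -compact_cover.
pose D : set (set X) :=
  [set A | [/\ open A, connected A & exists2 B, members U B & A `<=` B]].
have [|x _|D' D'D D'cover] := cptX _ D id; first by move=> A [].
  have [B UB Bx] := coverP U x.
  have [A [oA cA Ax AB]] := lcX x B (open_nbhs_nbhs (conj (open_members UB) Bx)).
  by exists A => //; split=> //; exists B.
have D'o (A : set X) : [set` D'] A -> D A by move=> /D'D; rewrite inE.
have D'openE (A : set X) : [set` D'] A -> open A by move=> /D'o[].
have D'coverE : \bigcup_(A in [set` D']) A = [set: X].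
  by apply/seteqP; split.
exists (OpenCover D'openE D'coverE); split=> /=.
- exact: finite_fset.
- by move=> A /D'o[].
- by move=> A /D'o[].
Qed.

End Connectedness.

(** * One-cocycles on the nerve of a cover *)

Section EdgeValue.
Variables (K : fieldType) (X : Type) (U : set (set X)).
Implicit Types (A B C : set X) (c : cochain K U 1).

Lemma simplex_exists q (v : 'I_q.+1 -> set X) x :
  (forall i, U (v i)) -> (forall i, v i x) ->
  exists s : simplex U q, forall i, s i = v i.
Proof.
move=> Uv vx; have vI : \bigcap_i v i !=set0 by exists x => i _; exact: vx.
by exists (Simplex Uv vI).
Qed.

Lemma edge_exists A B x : U A -> U B -> A x -> B x ->
  exists s : simplex U 1, s ord0 = A /\ s ord_max = B.
Proof.
move=> UA UB Ax Bx.
have [||s sv] := @simplex_exists 1 (fun i => if i == ord0 then A else B) x.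
- by move=> i; case: ifP.
- by move=> i; case: ifP.
by exists s; rewrite !sv.
Qed.

(** A 1-cochain as a function of two sets, so that the cocycle identity and
the choice of vertices can be handled without building simplices. *)
Definition edge_value c A B : K :=
  if pselect (exists s : simplex U 1, s ord0 = A /\ s ord_max = B) is left h
  then c (projT1 (cid h)) else 0.

Lemma edge_valueE c (s : simplex U 1) :
  edge_value c (s ord0) (s ord_max) = c s.
Proof.
rewrite /edge_value; case: pselect => [h|]; last by case; exists s.
case: cid => t /= [t0 t1]; congr c; apply: simplex_eq => i.
have : i = ord0 \/ i = ord_max.
  by case: i => [[|[|]]] // i; [left|right]; exact: val_inj.
by case=> ->.
Qed.

Lemma edge_value_cocycle c A B C x : cocycles c ->
  U A -> U B -> U C -> A x -> B x -> C x ->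
  edge_value c A B + edge_value c B C = edge_value c A C.
Proof.
move=> dc UA UB UC Ax Bx Cx.
have [||s sv] := @simplex_exists 2 (fun i => nth A [:: A; B; C] i) x.
- by case=> [[|[|[|]]]].
- by case=> [[|[|[|]]]].
have := congr1 (fun e => e s) dc.
rewrite /coboundary_op !big_ord_recl big_ord0 -!edge_valueE /= !sv /=.
rewrite /bump /= expr0 scale1r scaleN1r expr2 mulN1r opprK scale1r addr0.
move=> /eqP; rewrite -[X in _ == X]/(0 : K) addrCA addrC subr_eq0 addrC.
by move/eqP.
Qed.

Lemma coboundariesP c : coboundaries c <->
  exists p : set X -> K, forall A B x, U A -> U B -> A x -> B x ->
    edge_value c A B = p B - p A.
Proof.
split=> [[b _ <-]|[p cp]].
  pose p A := if pselect (exists s : simplex U 0, s ord0 = A) is left h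
    then b (projT1 (cid h)) else 0.
  have pE (s : simplex U 0) : p (s ord0) = b s.
    rewrite /p; case: pselect => [h|]; last by case; exists s.
    by case: cid => t /= t0; congr b; apply: simplex_eq => i; rewrite (ord1 i).
  exists p => A B x UA UB Ax Bx.
  have [s [<- <-]] := edge_exists UA UB Ax Bx.
  rewrite edge_valueE /coboundary_op !big_ord_recl big_ord0 /= -!pE /=.
  rewrite expr0 scale1r scaleN1r addr0.
  by congr (p (s _) - p (s _)); exact: val_inj.
exists (fun s : simplex U 0 => p (s ord0)) => //; apply/funext => s.
have [x sx] := vertex_meet s.
have := cp _ _ x (vertexP s ord0) (vertexP s ord_max) (sx ord0 I) (sx ord_max I).
rewrite edge_valueE => ->.
rewrite /coboundary_op !big_ord_recl big_ord0 /=.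
rewrite expr0 scale1r scaleN1r addr0.
by congr (p (s _) - p (s _)); exact: val_inj.
Qed.

End EdgeValue.

Lemma edge_value_pullback (K : fieldType) (X Y : Type) (f : X -> Y) p
    (V : set (set X)) (U : set (set Y)) (h : vertex_map f p V U)
    (c : cochain K U 1) A B x : V A -> V B -> A x -> B x ->
  edge_value (pullback h c) A B = edge_value c (p A) (p B).
Proof.
move=> VA VB Ax Bx; have [s [<- <-]] := edge_exists VA VB Ax Bx.
by rewrite edge_valueE; apply/esym/(edge_valueE c (map_simplex h s)).
Qed.

Lemma cech_class_eq0 (K : fieldType) (X : topologicalType) q
    (W V : open_cover X) (c : cochain K W q) (dc : cocycles c) p
    (hp : vertex_map id p V W) :
  coboundaries (pullback hp c) -> cech_class dc = 0.
Proof.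
move=> Bc; rewrite (cech_class_pullback dc hp) -[RHS]/(cech_zero K X q).
rewrite (cech_zeroE K q V); apply/cech_classP.
exists V, id, id, (@vertex_map_id X V), (@vertex_map_id X V) => /=.
by rewrite !pullback_id subr0.
Qed.

(** An equation between classes in the direct limit holds between cochains, up
to a coboundary, on some cover. *)
Lemma cech_eigenclass (K : fieldType) (X : topologicalType) (f : X -> X)
    (cf : continuous f) q (lambda : K) (W : open_cover X) (c : cochain K W q)
    (dc : cocycles c) :
  cech_map K cf q (cech_class dc) = lambda *: cech_class dc ->
  exists (T : open_cover X) p g (hp : vertex_map f p T W)
    (hg : vertex_map id g T W),
    coboundaries (pullback hp c - lambda *: pullback hg c).
Proof.
have [r hr] := preimage_vertex_map cf W.
rewrite (cech_mapE cf dc hr) -[RHS]/(cech_scale lambda _) cech_scaleE.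
move=> /cech_classP[T [t [g [ht [hg B]]]]].
exists T, _, g, (vertex_map_comp ht hr), hg.
by move: B; rewrite /= pullback_comp pullbackZ.
Qed.

(** * Primitives expanded by the map *)

Section LocalPrimitives.
Variables (R : realType) (X : topologicalType) (f : X -> X) (lambda : R[i]).
Hypothesis lambda1 : 1 < Normc.normc lambda.
Variables (U : set (set X)) (V : open_cover X).
Hypothesis finV : finite_set V.

(** With [a x] a chosen member of [V] containing [x], take
[F A x = c (g A) (g (a x)) + G x].  The cocycle identity gives the constants on
overlaps.  Relating the image vertices under [p] and under [g], which all
contain [f x], turns the eigenvalue equation into
[lambda * c (g A) (g (a x)) = c (g B) (g (a (f x))) - beta x] plus a constant
that depends on [A] and [B] only, and [G] is chosen to absorb [beta]. *)
Lemma local_primitives (p g : set X -> set X) (c : set X -> set X -> R[i])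
    (b : set X -> R[i]) :
  vertex_map f p V U -> vertex_map id g V U ->
  (forall A B C x, U A -> U B -> U C -> A x -> B x -> C x ->
    c A B + c B C = c A C) ->
  (forall A B x, members V A -> members V B -> A x -> B x ->
    c (p A) (p B) = lambda * c (g A) (g B) + (b B - b A)) ->
  exists (F : set X -> X -> R[i]) (M : R),
  [/\ forall A x, members V A -> Normc.normc (F A x) <= M,
    forall A B x, members V A -> members V B -> A x -> B x ->
      F A x - F B x = c (g A) (g B) &
    forall A B, members V A -> members V B -> exists k, forall x,
      A x -> B (f x) -> lambda * F A x = F B (f x) + k].
Proof.
move=> hp hg cD cb.
have [a aP] : exists a : X -> set X, forall x, members V (a x) /\ a x x.
  suff /choice[a aP] : forall x, exists A, members V A /\ A x by exists a.
  by move=> x; have [A VA Ax] := coverP V x; exists A.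
have Va x : members V (a x) by have [] := aP x.
have ax x : a x x by have [] := aP x.
pose beta x := b (a x) + c (p (a x)) (g (a (f x))).
have [C1 bC] := finite_set_bounded (fun A => Normc.normc (b A)) finV.
have [C2 cC] := finite_set_bounded2
  (fun A B => Normc.normc (c (p A) (g B))) finV.
have [C3 gC] := finite_set_bounded2
  (fun A B => Normc.normc (c (g A) (g B))) finV.
have [x|G [M [GM GE]]] := @cohomological_equation R X f lambda beta (C1 + C2) lambda1.
  apply: le_trans (normcD_le _ _) _; apply: lerD; [exact: bC|exact: cC].
have gP A x : members V A -> A x -> U (g A) /\ g A x.
  by move=> VA Ax; have [UgA AgA] := hg A VA; split=> //; exact: AgA.
have pP A x : members V A -> A x -> U (p A) /\ p A (f x).
  by move=> VA Ax; have [UpA ApA] := hp A VA; split=> //; exact: ApA.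
exists (fun A x => c (g A) (g (a x)) + G x), (C3 + M); split.
- move=> A x VA; apply: le_trans (normcD_le _ _) _; apply: lerD => //; exact: gC.
- move=> A B x VA VB Ax Bx.
  have [UgA gAx] := gP _ _ VA Ax; have [UgB gBx] := gP _ _ VB Bx.
  have [Uga gax] := gP _ _ (Va x) (ax x).
  by rewrite -(cD (g A) (g B) (g (a x)) x) // -(addrA (c (g A) (g B))) addrK.
- move=> A B VA VB; exists (c (p A) (g B) + b A) => x Ax Bfx.
  have [UpA pAx] := pP _ _ VA Ax; have [UgB gBx] := gP _ _ VB Bfx.
  have [Uga gax] := gP _ _ (Va (f x)) (ax (f x)).
  have [Upa pax] := pP _ _ (Va x) (ax x).
  have := cb A (a x) x VA (Va x) Ax (ax x).
  have := cD (p A) (p (a x)) (g (a (f x))) (f x) UpA Upa Uga pAx pax gax.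
  have := cD (p A) (g B) (g (a (f x))) (f x) UpA UgB Uga pAx gBx gax.
  rewrite mulrDr GE /beta => <- E1 E2.
  have -> : lambda * c (g A) (g (a x)) = c (p A) (p (a x)) - (b (a x) - b A).
    by rewrite E2 addrK.
  have -> : c (p A) (p (a x)) = c (p A) (g B) + c (g B) (g (a (f x)))
      - c (p (a x)) (g (a (f x))) by rewrite -E1 addrK.
  by ring.
Qed.

End LocalPrimitives.

Section Expansion.
Variables (R : realType) (X : topologicalType) (f : X -> X) (lambda : R[i]).
Hypotheses (cf : continuous f) (lambda1 : 1 < Normc.normc lambda).
Variable V : open_cover X.
Hypothesis finV : finite_set V.
Hypothesis conV : forall A, members V A -> connected A.
Variables (F : set X -> X -> R[i]) (M : R).
Hypothesis FM : forall A x, members V A -> Normc.normc (F A x) <= M.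
Hypothesis Fbranch : forall A B, members V A -> members V B ->
  exists k, forall x, A x -> B x -> F A x = F B x + k.
Hypothesis Fexpand : forall A B, members V A -> members V B ->
  exists k, forall x, A x -> B (f x) -> lambda * F A x = F B (f x) + k.

Lemma iterated_join_expand n W : iterated_join f V n W ->
  exists A B k, [/\ members V A, members V B & forall x, W x ->
    [/\ A x, B (iter n f x) & lambda ^+ n * F A x = F B (iter n f x) + k]].
Proof.
elim: n W => [|n IH] W.
  move=> VW; exists W, W, 0; split=> // x Wx.
  by split=> //; rewrite expr0 mul1r addr0.
move=> [W' nW' [_ [C VC <-] <-]]; have [A [B [k [VA VB kP]]]] := IH _ nW'.
have [k' k'P] := Fexpand VB VC.
exists A, C, (k' + lambda * k); split=> // x [/kP[Ax Bx E] Cx]; split=> //.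
by rewrite exprS -mulrA E mulrDr k'P // addrA.
Qed.

(** On [W], the function [lambda ^+ n * F A] is a branch of the primitive at
time [n] up to a constant, and the branches are bounded by [M]. *)
Lemma iterated_join_contract n W A x y : iterated_join f V n W ->
  members V A -> A x -> A y -> W x -> W y ->
  Normc.normc (F A x - F A y) <= M *+ 2 / Normc.normc lambda ^+ n.
Proof.
move=> nW VA Ax Ay Wx Wy.
have [A0 [B [k [VA0 VB kP]]]] := iterated_join_expand nW.
have [k' k'P] := Fbranch VA VA0.
have [A0x Bx Ex] := kP x Wx; have [A0y By Ey] := kP y Wy.
have l0 : 0 < Normc.normc lambda by exact: lt_trans lambda1.
rewrite ler_pdivlMr ?exprn_gt0 // mulrC -normcX -Normc.normcM.
have -> : lambda ^+ n * (F A x - F A y) = F B (iter n f x) - F B (iter n f y).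
  rewrite !k'P // (addrC (F A0 y)) addrKA mulrBr Ex Ey.
  by rewrite (addrC (F B (iter n f y))) addrKA.
by rewrite mulr2n; apply: le_trans (normcB_le _ _) _; rewrite lerD ?FM.
Qed.

(** The oscillation of [F A] between [x] and [y] is a fixed positive number,
and it is at most the number of members of a subcover of the [n]-th join times
[2 M / |lambda| ^ n]. *)
Lemma nonconstant_entropy A x y : members V A -> A x -> A y ->
  F A x != F A y ->
  ln (Normc.normc lambda) <= cover_entropy R f V.
Proof.
move=> VA Ax Ay Fxy.
set k := Normc.normc lambda.
have k0 : 0 < k by exact: lt_trans lambda1.
pose d := Normc.normc (F A x - F A y).
have d0 : 0 < d.
  rewrite lt_neqAle normc_ge0 andbT eq_sym; apply: contra Fxy => /eqP d0.
  by rewrite -subr_eq0; apply/eqP; exact: Normc.eq0_normc.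
have dM : d <= M *+ 2.
  by rewrite mulr2n; apply: le_trans (normcB_le _ _) _; rewrite lerD ?FM.
have M0 : 0 < M *+ 2 by exact: lt_le_trans dM.
apply: (cover_entropy_ge cf finV (k := k) (e := d / (M *+ 2)) x k0).
  by rewrite divr_gt0.
move=> n.
have [W [nW Wc]] := min_subcover_card_attained (iterated_join_finite f n finV)
  (iterated_join_cover cf V n).
set s := min_subcover_card _ in nW Wc *.
have := connected_oscillation (conV VA) (fun i si => iterated_join_open cf (nW i si))
  Wc (F := F A) (e := M *+ 2 / k ^+ n).
move=> /(_ _ x y Ax Ay); rewrite -/d => dn.
rewrite mulrAC ler_pdivrMr // -ler_pdivlMr ?exprn_gt0 //.
rewrite mulr_natl mulrnAl; apply: dn => i z w si Az Aw Wz Ww.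
exact: (iterated_join_contract (nW i si)).
Qed.

End Expansion.

(** * The lower bound on the entropy *)

Theorem theorem25 (R : realType) (X : topologicalType) (f : X -> X)
    (cptX : compact [set: X]) (lcX : locally_connected X)
    (cf : continuous f) (lambda : R[i]) :
  is_eigenvalue (cech_map R[i] cf 1) lambda ->
  1 < Normc.normc lambda ->
  ((ln (Normc.normc lambda))%:E <= topological_entropy R f)%E.
Proof.
move=> [v v0 fv] lambda1.
rewrite (cech_repr v) in v0 fv.
move: (cocycle_cover (repr v)) (cocycle_cochain (repr v)) (cocycleP (repr v))
  v0 fv => U c dc v0 /cech_eigenclass[T [p0 [g0 [hp0 [hg0 B]]]]].
(* On an empty space the nerve has no edges and every cochain vanishes. *)
have [[x0]|X0] := pselect (inhabited X); last first.
  case/eqP: v0; apply: (@cech_class_eq0 _ _ _ _ U c dc _ (@vertex_map_id X U)).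
  by apply/coboundariesP; exists (fun=> 0) => A C x; case: X0; exists.
have [V [finV conV VT]] := finite_connected_refinement T x0 cptX lcX.
have [t ht] : exists t, vertex_map id t V T by exact: vertex_map_ex.
pose hp := vertex_map_comp ht hp0; pose hg := vertex_map_comp ht hg0.
have /coboundariesP[b bP] : coboundaries (pullback hp c - lambda *: pullback hg c).
  by move: (pullback_coboundaries ht B); rewrite pullbackB pullbackZ !pullback_comp.
have cD A C D x := @edge_value_cocycle _ _ _ c A C D x dc.
have cb A C x : members V A -> members V C -> A x -> C x ->
    edge_value c ((p0 \o t) A) ((p0 \o t) C) =
    lambda * edge_value c ((g0 \o t) A) ((g0 \o t) C) + (b C - b A).
  move=> VA VC Ax Cx; rewrite -(bP A C x) //.
  rewrite -(edge_value_pullback hp c VA VC Ax Cx).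
  rewrite -(edge_value_pullback hg c VA VC Ax Cx).
  have [s [<- <-]] := edge_exists VA VC Ax Cx.
  by rewrite !edge_valueE addrC subrK.
have [F [M [FM Fc Fexpand]]] := local_primitives lambda1 finV hp hg cD cb.
have Fbranch A B' : members V A -> members V B' ->
    exists k, forall x, A x -> B' x -> F A x = F B' x + k.
  move=> VA VB; exists (edge_value c ((g0 \o t) A) ((g0 \o t) B')) => x Ax Bx.
  by rewrite -(Fc _ _ x) // addrC subrK.
apply: (le_trans (y := (cover_entropy R f V)%:E)); last first.
  by apply: ereal_sup_ubound; exists V.
rewrite lee_fin; have [[A [x [y [VA Ax Ay /eqP Fxy]]]]|Fconst] := pselect
  (exists A x y, [/\ members V A, A x, A y & F A x <> F A y]).
  exact: (nonconstant_entropy cf lambda1 finV conV FM Fbranch Fexpand VA Ax Ay).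
(* All [F A] are constant: the value at any point of [A] is a potential. *)
exfalso; case/eqP: v0; apply: (@cech_class_eq0 _ _ _ _ V c dc _ hg).
apply/coboundariesP; exists (fun A => - F A (xget x0 A)) => A C x VA VC Ax Cx.
have pickE D : members V D -> D x -> F D (xget x0 D) = F D x.
  move=> VD Dx; apply: contrapT => ne; apply: Fconst.
  by exists D, (xget x0 D), x; split=> //; exact: (xgetPex x0 (ex_intro _ x Dx)).
rewrite (edge_value_pullback hg c VA VC Ax Cx) -[LHS](Fc _ _ x) //.
by rewrite !pickE // opprK addrC.
Qed.
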